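(* Let $I,J\in\mathbb{N}$, $C=(c^{ij})\in\mathbb{R}^{I\times J}$, $x\in\mathcal{P}_I$, $y\in\mathcal{P}_J$. Assume: (i) $\Pi(x,y)\neq\operatorname*{argmin}_{\Pi\in\Pi(x,y)}\langle C,\Pi\rangle$; (ii) $U\in C([0,1])\cap C^1((0,1])\cap C^2((0,1))$ satisfies $U''>0$ on $(0,1)$, $\lim_{h\downarrow 0}U'(h)=-\infty$, and $r\mapsto rU''(r)$ is non-decreasing on $(0,1)$. Then the interval \[ \left(0,\frac{\Delta_C(x,y)\,R_U(x,y)}{\mathfrak{D}_U(x,y)}\right]\cap\left(0,\frac{\Delta_C(x,y)}{\mathfrak{D}_U(x,y)+\nu_U(x,y)-U'(1)}\right] \] is well-defined and nonempty, and for every $\varepsilon$ in this interval, \[ \langle C,\Pi^U(C,x,y,\varepsilon)\rangle-\inf_{\Pi\in\Pi(x,y)}\langle C,\Pi\rangle\le \Delta_C(x,y)\cdot e_U\!\left(-\frac{\Delta_C(x,y)}{\varepsilon}+\mathfrak{D}_U(x,y)+\nu_U(x,y)\right). \]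
   Context: For $K\in\mathbb{N}$, $\mathcal{P}_K=\{z\in\mathbb{R}^K: z_k\ge 0,\ \sum_k z_k=1\}$. For $x\in\mathcal{P}_I,y\in\mathcal{P}_J$, $(x\otimes y)_{ij}=x_iy_j$, and $\Pi(x,y)$ is the set of $\Pi=(\pi_{ij})\in\mathcal{P}_{I\times J}$ (viewed in $\mathbb{R}^{I\times J}$) with $\sum_{l}\pi_{il}=x_i$ and $\sum_l \pi_{lj}=y_j$ for all $i,j$; it is a convex polytope, and $V(x,y)$ denotes its set of vertices. $\langle C,\Pi\rangle=\sum_{i,j}c^{ij}\pi_{ij}$. For $U$ continuous strictly convex on $[0,1]$ and $C^1$ on $(0,1]$: $d_U(r,r_0)=U(r)-U(r_0)-(r-r_0)U'(r_0)$ for $r\in[0,1]$, $r_0\in(0,1]$, extended by $d_U(r,0)=\lim_{r_0\downarrow0}d_U(r,r_0)\in[0,\infty]$; $D_U(z,w)=\sum_k d_U(z_k,w_k)$ for $z,w\in\mathcal{P}_K$. For $\varepsilon>0$, $\Pi^U(C,x,y,\varepsilon)$ is the unique minimizer over $\Pi(x,y)$ of $\langle C,\Pi\rangle+\varepsilon D_U(\Pi,x\otimes y)$. $\mathfrak{D}_U(x,y)=\sup_{\Pi\in\Pi(x,y)}D_U(\Pi,x\otimes y)$. $\Delta_C(x,y)=\inf_{V'\in V(x,y)\setminus\operatorname*{argmin}_{V\in V(x,y)}\langle C,V\rangle}\langle C,V'\rangle-\inf_{V\in V(x,y)}\langle C,V\rangle$ (with $\inf\emptyset=\infty$). Under (ii):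 $e_U$ is the inverse function of $U':(0,1]\to U'((0,1])$; $R_U(x,y)\in[1/2,1)$ is the unique number with $U'(R_U(x,y))-U'(1-R_U(x,y))=\mathfrak{D}_U(x,y)$; and $\nu_U(x,y)=\sup_{r\in(0,R_U(x,y)]}\big(U'(1-r)+rU''(r)\big)$. *)

(* Defs.v *)
From HB Require Import structures.
From mathcomp Require Import all_boot all_order all_algebra.
From mathcomp Require Import all_classical all_reals all_analysis.
Set Implicit Arguments. Unset Strict Implicit. Unset Printing Implicit Defensive.
Import Order.TTheory GRing.Theory Num.Theory.
Import numFieldNormedType.Exports.
Local Open Scope classical_set_scope.
Local Open Scope ring_scope.

Section Defs.
Variable R : realType.

Definition prob_vec (K : nat) (z : 'I_K -> R) : Prop :=
  (forall k, 0 <= z k) /\ \sum_(k < K) z k = 1.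

Definition otimes (I J : nat) (x : 'I_I -> R) (y : 'I_J -> R) : 'M[R]_(I, J) :=
  \matrix_(i < I, j < J) (x i * y j).

Definition coupling (I J : nat) (x : 'I_I -> R) (y : 'I_J -> R) : set 'M[R]_(I, J) :=
  [set P | (forall i j, 0 <= P i j) /\ \sum_(i < I) \sum_(j < J) P i j = 1 /\
           (forall i, \sum_(l < J) P i l = x i) /\
           (forall j, \sum_(l < I) P l j = y j)].

Definition cost (I J : nat) (C P : 'M[R]_(I, J)) : R :=
  \sum_(i < I) \sum_(j < J) C i j * P i j.

Definition vertices (I J : nat) (x : 'I_I -> R) (y : 'I_J -> R) : set 'M[R]_(I, J) :=
  [set V | coupling x y V /\
     forall (A B : 'M[R]_(I, J)) (t : R), coupling x y A -> coupling x y B ->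
       0 < t < 1 -> V = t *: A + (1 - t) *: B -> A = B].

Definition argmin_cost (I J : nat) (C : 'M[R]_(I, J)) (S : set 'M[R]_(I, J))
  : set 'M[R]_(I, J) :=
  [set P | S P /\ forall Q, S Q -> cost C P <= cost C Q].

(* Delta_C(x,y), with inf of the empty set = +oo *)
Definition DeltaC (I J : nat) (C : 'M[R]_(I, J)) (x : 'I_I -> R) (y : 'I_J -> R)
  : \bar R :=
  (ereal_inf [set (cost C V)%:E | V in
               vertices x y `\` argmin_cost C (vertices x y)]
   - ereal_inf [set (cost C V)%:E | V in vertices x y])%E.

(* U' on (0,1]: the derivative on (0,1), and at 1 the limit of U' from the left
   (U is C^1 on (0,1]) *)
Definition Uprime (U : R -> R) (r : R) : R :=
  if r < 1 then derive1 U r else lim (derive1 U t @[t --> 1^'-]).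

Definition Usecond (U : R -> R) (r : R) : R := derive1 (derive1 U) r.

Definition dU (U : R -> R) (r r0 : R) : \bar R :=
  if 0 < r0 then (U r - U r0 - (r - r0) * Uprime U r0)%:E
  else lim ((U r - U t - (r - t) * Uprime U t)%:E @[t --> 0^'+]).

Definition DU (U : R -> R) (I J : nat) (z w : 'M[R]_(I, J)) : \bar R :=
  (\sum_(i < I) \sum_(j < J) dU U (z i j) (w i j))%E.

Definition is_PiU (U : R -> R) (I J : nat) (C : 'M[R]_(I, J))
  (x : 'I_I -> R) (y : 'I_J -> R) (eps : R) (P : 'M[R]_(I, J)) : Prop :=
  coupling x y P /\
  forall Q, coupling x y Q ->
    ((cost C P)%:E + eps%:E * DU U P (otimes x y)
      <= (cost C Q)%:E + eps%:E * DU U Q (otimes x y))%E.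

Definition PiU (U : R -> R) (I J : nat) (C : 'M[R]_(I, J))
  (x : 'I_I -> R) (y : 'I_J -> R) (eps : R) : 'M[R]_(I, J) :=
  xget 0 (is_PiU U C x y eps).

Definition DfrakU (U : R -> R) (I J : nat) (x : 'I_I -> R) (y : 'I_J -> R) : \bar R :=
  ereal_sup [set DU U P (otimes x y) | P in coupling x y].

Definition eU (U : R -> R) (s : R) : R :=
  xget 0 [set r | 0 < r <= 1 /\ Uprime U r = s].

Definition RU (U : R -> R) (I J : nat) (x : 'I_I -> R) (y : 'I_J -> R) : R :=
  xget 0 [set r | 1/2 <= r < 1 /\ (Uprime U r - Uprime U (1 - r))%:E = DfrakU U x y].

Definition nuU (U : R -> R) (I J : nat) (x : 'I_I -> R) (y : 'I_J -> R) : \bar R :=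
  ereal_sup [set (Uprime U (1 - r) + r * Usecond U r)%:E | r in `]0, RU U x y]].

Definition min_cost (I J : nat) (C : 'M[R]_(I, J)) (x : 'I_I -> R) (y : 'I_J -> R)
  : \bar R :=
  ereal_inf [set (cost C P)%:E | P in coupling x y].

End Defs.

(* Main.v *)
(* Let m be the minimal cost and Delta the gap to the cheapest non-optimal vertex.
   Writing the minimizer P as a convex combination of vertices and collecting the
   optimal ones gives P = (1 - mu) O + mu N, with O optimal, N a coupling and
   mu = (cost P - m) / Delta. Comparing P with O in the regularized problem gives
   mu Delta <= eps (D(O) - D(P)), hence mu <= R by the first bound on eps.
   Since r U''(r) is non-decreasing, the Jensen gap of D along [O, N] is at most
   the gap U(0) + U(1) - U(mu) - U(1 - mu) between two distinct Dirac masses,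
   which is at most mu (nu - U'(mu)) for mu <= R. Therefore
   Delta / eps <= D + nu - U'(mu), i.e. mu <= e_U(- Delta / eps + D + nu). *)

Require Import Defs.
From HB Require Import structures.
From mathcomp Require Import all_boot all_order all_algebra.
From mathcomp Require Import all_classical all_reals all_analysis.
From mathcomp Require Import ring lra.
Import Order.TTheory GRing.Theory Num.Theory.
Import numFieldNormedType.Exports.
Local Open Scope classical_set_scope.
Local Open Scope ring_scope.
Set Implicit Arguments. Unset Strict Implicit. Unset Printing Implicit Defensive.

(** * Couplings as a polytope: supports, rays and vertices *)

Lemma couplingP (R : realType) (I J : nat) (x : 'I_I -> R) (y : 'I_J -> R)
    (P : 'M[R]_(I, J)) : prob_vec x ->
  coupling x y P <->
  [/\ forall i j, 0 <= P i j, forall i, \sum_(l < J) P i l = x i &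
      forall j, \sum_(l < I) P l j = y j].
Proof.
move=> [_ x1]; split=> [[P0 [_ [Px Py]]]|[P0 Px Py]]; first by split.
by split=> //; split=> //; under eq_bigr do rewrite Px.
Qed.

Lemma coupling_le1 (R : realType) (I J : nat) (x : 'I_I -> R) (y : 'I_J -> R)
    (P : 'M[R]_(I, J)) i j : coupling x y P -> P i j <= 1.
Proof.
move=> [P0 [<- _]]; rewrite (bigD1 i)//= (bigD1 j)//= -addrA lerDl.
by rewrite addr_ge0 ?sumr_ge0// => k _; rewrite sumr_ge0.
Qed.

Lemma coupling_otimes (R : realType) (I J : nat) (x : 'I_I -> R)
    (y : 'I_J -> R) : prob_vec x -> prob_vec y -> coupling x y (otimes x y).
Proof.
move=> hx hy; apply/(couplingP _ _ hx); split => [i j|i|j].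
- by rewrite mxE mulr_ge0 ?(proj1 hx) ?(proj1 hy).
- by under eq_bigr do rewrite mxE; rewrite -mulr_sumr (proj2 hy) mulr1.
- by under eq_bigr do rewrite mxE; rewrite -mulr_suml (proj2 hx) mul1r.
Qed.

Lemma cost_lin (R : realType) (I J : nat) (C A B : 'M[R]_(I, J)) (s t : R) :
  cost C (s *: A + t *: B) = s * cost C A + t * cost C B.
Proof.
rewrite /cost !mulr_sumr -big_split/=; apply: eq_bigr => i _.
rewrite !mulr_sumr -big_split/=; apply: eq_bigr => j _.
by rewrite !mxE; ring.
Qed.

Definition msupp (R : realType) (I J : nat) (P : 'M[R]_(I, J)) :
  {set 'I_I * 'I_J} := [set k | P k.1 k.2 != 0]%SET.

Lemma in_msupp (R : realType) (I J : nat) (P : 'M[R]_(I, J)) i j :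
  ((i, j) \in msupp P) = (P i j != 0).
Proof. by rewrite inE. Qed.

(* Moving from P along E until an entry first vanishes. *)
Lemma coupling_ray (R : realType) (I J : nat) (x : 'I_I -> R)
    (y : 'I_J -> R) (P E : 'M[R]_(I, J)) : prob_vec x -> coupling x y P ->
  E != 0 -> (forall i, \sum_j E i j = 0) -> (forall j, \sum_i E i j = 0) ->
  msupp E \subset msupp P ->
  exists s, [/\ 0 < s, coupling x y (P + s *: E) &
                msupp (P + s *: E) \proper msupp P].
Proof.
move=> hx cP E0 Er Ec EP.
(* A nonnegative matrix with zero row sums vanishes, so [E] has a negative entry. *)
have [k0 Ek0] : exists k, E k.1 k.2 < 0.
  apply: contrapT => /forallNP Ege; move/negP: E0; apply; apply/eqP/matrixP.
  have Ege0 i j : 0 <= E i j by rewrite leNgt; apply/negP; exact: (Ege (i, j)).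
  move=> i j; rewrite mxE; apply: (psumr_eq0P _ (Er i)) => //.
(* Ratio test: among the entries decreasing along [E], [k] reaches zero first, so the step
   [P k / - E k] keeps all entries nonnegative. *)
have [k Ek kmin] := @arg_minP _ _ _ k0 (fun k => E k.1 k.2 < 0)
  (fun k => P k.1 k.2 / - E k.1 k.2) Ek0.
have /(couplingP _ _ hx)[P0 Px Py] := cP.
have supP i j : E i j != 0 -> 0 < P i j.
  move=> Eij; rewrite lt_neqAle P0 andbT eq_sym -in_msupp.
  by apply: (fintype.subsetP EP); rewrite in_msupp.
have s0 : 0 < P k.1 k.2 / - E k.1 k.2.
  by rewrite divr_gt0 ?oppr_gt0// supP// lt_eqF.
exists (P k.1 k.2 / - E k.1 k.2); split => //.
- apply/(couplingP _ _ hx); split => [i j|i|j].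
  + rewrite !mxE; have [Eij|Eij] := ltP (E i j) 0.
      have /= := kmin (i, j) Eij; rewrite ler_pdivlMr ?oppr_gt0//.
      by rewrite mulrN -subr_ge0 opprK.
    by rewrite addr_ge0// mulr_ge0// ltW.
  + under eq_bigr do rewrite !mxE.
    by rewrite big_split/= -mulr_sumr Er mulr0 addr0.
  + under eq_bigr do rewrite !mxE.
    by rewrite big_split/= -mulr_sumr Ec mulr0 addr0.
- apply/properP; split.
    apply/fintype.subsetP => -[i j]; rewrite !in_msupp !mxE.
    have [Eij|/supP/gt_eqF->//] := eqVneq (E i j) 0.
    by rewrite Eij mulr0 addr0.
  exists k; first by rewrite inE gt_eqF// supP// lt_eqF.
  rewrite inE negbK !mxE invrN mulrN mulNr divfK ?subrr//.
  by rewrite lt_eqF.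
Qed.

(** If [W] differed from [V], one could move from [V] a little away from [W] inside the polytope,
    because [V - W] lives on the support of [V]. Then [V] would lie strictly between [W] and the
    point reached. *)
Lemma vertices_msupp_inj (R : realType) (I J : nat) (x : 'I_I -> R)
    (y : 'I_J -> R) (V W : 'M[R]_(I, J)) : prob_vec x ->
  vertices x y V -> coupling x y W -> msupp W \subset msupp V -> V = W.
Proof.
move=> hx [cV Vext] cW WV; apply/eqP/negPn/negP => VW.
have [] := @coupling_ray _ _ _ x y V (V - W) hx cV.
- by rewrite subr_eq0.
- move=> i; under eq_bigr do rewrite !mxE; rewrite sumrB.
  by rewrite (proj1 (proj2 (proj2 cV))) (proj1 (proj2 (proj2 cW))) subrr.
- move=> j; under eq_bigr do rewrite !mxE; rewrite sumrB.
  by rewrite (proj2 (proj2 (proj2 cV))) (proj2 (proj2 (proj2 cW))) subrr.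
- apply/fintype.subsetP => -[i j]; rewrite !in_msupp !mxE; apply: contraNN.
  move=> /eqP V0; suff /eqP -> : W i j == 0 by rewrite V0 subrr.
  apply/negPn; rewrite -in_msupp; apply/negP => /(fintype.subsetP WV).
  by rewrite in_msupp V0 eqxx.
move=> s [s0 cA _]; have s1 : 0 < 1 + s by rewrite addr_gt0.
have s1' := lt0r_neq0 s1.
(* This is the weight of [V + s *: (V - W)] when [V] is written as a combination of that point and
   [W]. *)
have s01 : 0 < (1 + s)^-1 < 1 by rewrite invr_gt0 s1 invf_lt1// ltrDl s0.
have eqW := Vext _ W _ cA cW s01.
move/eqP: VW; apply; apply/matrixP => i j.
have {}eqW : V + s *: (V - W) = W.
  by apply: eqW; apply/matrixP => k l; rewrite !mxE; field.
have := congr1 (fun M : 'M[R]_(I, J) => M i j) eqW; rewrite !mxE => h.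
have : (1 + s) * (V i j - W i j) = 0.
  by rewrite -[in X in _ = X](subrr (W i j)) -{2}h; ring.
by move/eqP; rewrite mulf_eq0 (negbTE s1')/= subr_eq0 => /eqP.
Qed.

(** Every coupling is a convex combination of vertices, in the form of an induction principle. A
    non-vertex is interior to a segment of couplings; following its direction both ways until an
    entry vanishes exhibits it as a combination of two couplings of smaller support. *)
Lemma coupling_ind (R : realType) (I J : nat) (x : 'I_I -> R)
    (y : 'I_J -> R) (Q : 'M[R]_(I, J) -> Prop) : prob_vec x ->
  (forall V, vertices x y V -> Q V) ->
  (forall A B t, coupling x y A -> coupling x y B -> 0 < t < 1 ->
     Q A -> Q B -> Q (t *: A + (1 - t) *: B)) ->
  forall P, coupling x y P -> Q P.
Proof.
move=> hx QV Qc P; have [n] := ubnP #|msupp P|; elim: n P => // n IH P.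
rewrite ltnS => Pn cP.
have [/QV//|nV] := pselect (vertices x y P).
have [A [B [t [cA cB t01 PAB AB]]]] : exists A B t,
    [/\ coupling x y A, coupling x y B, 0 < t < 1,
        P = t *: A + (1 - t) *: B & A <> B].
  apply: contrapT => nex; apply: nV; split => // A B t cA cB t01 PAB.
  by apply: contrapT => AB; apply: nex; exists A, B, t.
have hr (A' B' : 'M[R]_(I, J)) : coupling x y A' -> coupling x y B' ->
    forall i, \sum_j (A' - B') i j = 0.
  move=> cA' cB' i; under eq_bigr do rewrite !mxE; rewrite sumrB.
  by rewrite (proj1 (proj2 (proj2 cA'))) (proj1 (proj2 (proj2 cB'))) subrr.
have hc (A' B' : 'M[R]_(I, J)) : coupling x y A' -> coupling x y B' ->
    forall j, \sum_i (A' - B') i j = 0.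
  move=> cA' cB' i; under eq_bigr do rewrite !mxE; rewrite sumrB.
  by rewrite (proj2 (proj2 (proj2 cA'))) (proj2 (proj2 (proj2 cB'))) subrr.
have sub : forall i j, P i j = 0 -> A i j = 0 /\ B i j = 0.
  move=> i j /eqP; rewrite PAB !mxE; have /andP[t0 t1] := t01.
  have ? := proj1 cA i j; have ? := proj1 cB i j.
  have u0 : 0 < 1 - t by rewrite subr_gt0.
  rewrite paddr_eq0; [|exact: mulr_ge0 (ltW t0) _|exact: mulr_ge0 (ltW u0) _].
  rewrite !mulf_eq0 (gt_eqF t0) (gt_eqF u0)/=.
  by move=> /andP[/eqP -> /eqP ->].
have [||||s [s0 cs ps]] := @coupling_ray _ _ _ x y P (A - B) hx cP.
- by rewrite subr_eq0; apply/eqP.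
- exact: hr.
- exact: hc.
- apply/fintype.subsetP => -[i j]; rewrite !in_msupp !mxE.
  by apply: contraNN => /eqP/sub[-> ->]; rewrite subrr.
have [||||r [r0 cr pr]] := @coupling_ray _ _ _ x y P (B - A) hx cP.
- by rewrite subr_eq0 eq_sym; apply/eqP.
- exact: hr.
- exact: hc.
- apply/fintype.subsetP => -[i j]; rewrite !in_msupp !mxE.
  by apply: contraNN => /eqP/sub[-> ->]; rewrite subrr.
have rs0 : 0 < r + s by rewrite addr_gt0.
(* The endpoints lie at parameters [s] and [- r] along [A - B], hence these weights. *)
have -> : P = (r / (r + s)) *: (P + s *: (A - B)) +
              (1 - r / (r + s)) *: (P + r *: (B - A)).
  by apply/matrixP => i j; rewrite !mxE; field; rewrite gt_eqF.
apply: Qc => //.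
- by rewrite divr_gt0//= ltr_pdivrMr// mul1r ltrDl.
- by apply: IH => //; apply: leq_trans (proper_card ps) Pn.
- by apply: IH => //; apply: leq_trans (proper_card pr) Pn.
Qed.

(* A vertex is determined by its support, so a set of vertices is finite. *)
Lemma vertices_argmin (R : realType) (I J : nat) (x : 'I_I -> R)
    (y : 'I_J -> R) (f : 'M[R]_(I, J) -> R) (A : set 'M[R]_(I, J)) :
  prob_vec x -> A `<=` vertices x y -> A !=set0 ->
  exists2 V, A V & forall W, A W -> f V <= f W.
Proof.
move=> hx AV [V0 AV0].
pose T S := [set V : 'M[R]_(I, J) | A V /\ msupp V = S].
(* A vertex is recovered from its support, so minimizing over [A] becomes minimizing over a finite
   type of supports. *)
have TV V : A V -> xget 0 (T (msupp V)) = V.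
  move=> HV; have [HW eS] : T (msupp V) (xget 0 (T (msupp V))).
    by apply: (@xgetPex _ 0); exists V.
  apply: (@vertices_msupp_inj _ _ _ x y) => //; first exact: AV.
    by case: (AV _ HV).
  by rewrite eS.
have PS0 : `[< exists V, T (msupp V0) V >] by apply/asboolP; exists V0.
have [S /asboolP[V [HV <-]] Smin] := @arg_minP _ _ _ (msupp V0)
  (fun S => `[< exists V, T S V >]) (fun S => f (xget 0 (T S))) PS0.
exists V => // W HW; rewrite -(TV _ HV) -(TV _ HW); apply: Smin.
by apply/asboolP; exists W.
Qed.

(** * The cost gap and the splitting of a coupling into optimal and other vertices *)

Lemma ereal_inf_image_min (R : realType) (T : Type) (f : T -> R) (A : set T) a :
  A a -> (forall b, A b -> f a <= f b) ->
  ereal_inf [set (f b)%:E | b in A] = (f a)%:E.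
Proof.
move=> Aa amin; apply/eqP; rewrite eq_le; apply/andP; split.
  by apply: ereal_inf_lbound; exists a.
by apply: le_ereal_inf_tmp => _ [b Ab <-]; rewrite lee_fin amin.
Qed.

(** All the linear programming in the proof: both infima are attained because vertices are finitely
    many, and the last clause splits [P] into an optimal coupling and a remainder of weight [mu]. *)
Lemma cost_gap (R : realType) (I J : nat) (C : 'M[R]_(I, J))
    (x : 'I_I -> R) (y : 'I_J -> R) : prob_vec x -> prob_vec y ->
  coupling x y <> argmin_cost C (coupling x y) ->
  exists m d : R, [/\ 0 < d, DeltaC C x y = d%:E, min_cost C x y = m%:E,
    exists2 O, coupling x y O & cost C O = m &
    forall P mu, coupling x y P -> 0 < mu < 1 -> cost C P - m = mu * d ->
      exists O N, [/\ coupling x y O, coupling x y N, cost C O = m &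
                      P = (1 - mu) *: O + mu *: N]].
Proof.
move=> hx hy hi; pose Vs := vertices x y.
have Vs0 : Vs !=set0.
  by apply: (coupling_ind (Q := fun=> Vs !=set0)) (coupling_otimes hx hy);
    [|move=> V VV; exists V|].
have [V0 VV0 V0min] := vertices_argmin (cost C) hx (@subset_refl _ Vs) Vs0.
have cV V : Vs V -> coupling x y V by case.
have minP P : coupling x y P -> cost C V0 <= cost C P.
  move: P; apply: coupling_ind => // A B t cA cB /andP[t0 t1] mA mB.
  rewrite cost_lin; nra.
set m := cost C V0 in minP V0min *.
pose Bs := Vs `\` argmin_cost C Vs.
have BsP V : Bs V <-> Vs V /\ m < cost C V.
  split => [[VV nV]|[VV mV]]; split => //.
    rewrite ltNge; apply/negP => Vm; apply: nV; split => // W /V0min.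
    exact: le_trans.
  by case=> _ /(_ _ VV0); rewrite leNgt mV.
(* If all vertices were optimal, the cost would be constant on couplings, against (i). *)
have Bs0 : Bs !=set0.
  apply: contrapT => nB; apply: hi.
  have cm P : coupling x y P -> cost C P = m.
    move: P; apply: coupling_ind => // [V VV|A B t _ _ _ mA mB].
      apply/eqP; rewrite eq_le V0min// andbT leNgt; apply/negP => mV.
      by apply: nB; exists V; apply/BsP.
    by rewrite cost_lin mA mB; ring.
  apply/seteqP; split => [P cP|P []//]; split=> // Q cQ.
  by rewrite (cm _ cP) (cm _ cQ).
have BsV : Bs `<=` Vs by move=> ? [].
have [V1 BV1 V1min] := vertices_argmin (cost C) hx BsV Bs0.
have [VV1 mV1] := (BsP V1).1 BV1.
pose d := cost C V1 - m; have d0 : 0 < d by rewrite subr_gt0.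
exists m, d; split => //.
- rewrite /DeltaC (ereal_inf_image_min (a := V1))// (ereal_inf_image_min (a := V0))//.
- by rewrite /min_cost (ereal_inf_image_min (a := V0))//; exact: cV.
- by exists V0 => //; exact: cV.
(* [c] is the weight in [P] of the optimal vertices and [K] their part of [P]. *)
pose Q (P : 'M[R]_(I, J)) := exists (c : R) (K : 'M[R]_(I, J)),
  [/\ forall i j, 0 <= K i j <= P i j,
      forall i, \sum_j K i j = c * x i, forall j, \sum_i K i j = c * y j,
      cost C K = c * m & (1 - c) * d <= cost C P - m].
have QP P : coupling x y P -> Q P.
  move: P; apply: coupling_ind => // [V VV|A B t cA cB /andP[t0 t1]].
    have [V0_ Vx Vy] := (couplingP y V hx).1 (cV _ VV).
    (* A non-optimal vertex has no optimal part, so [c = 0], and its gap is at least [d] by the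
       choice of [V1]; an optimal one has [c = 1]. *)
    have [BV|nBV] := pselect (Bs V).
      exists 0, 0; split => [i j|i|j||].
      + by rewrite mxE lexx V0_.
      + by rewrite mul0r big1// => j _; rewrite mxE.
      + by rewrite mul0r big1// => i _; rewrite mxE.
      + rewrite mul0r /cost big1// => i _; rewrite big1// => j _.
        by rewrite mxE mulr0.
      + by rewrite subr0 mul1r lerB// V1min.
    exists 1, V; split => [i j|i|j||]; rewrite ?mul1r//.
    + by rewrite V0_ lexx.
    + apply/eqP; rewrite eq_le V0min// andbT leNgt; apply/negP => mV.
      by apply/nBV/BsP.
    + by rewrite subrr mul0r subr_ge0 V0min.
  move=> [a [K [Kb Kx Ky Km Kd]]] [b [L [Lb Lx Ly Lm Ld]]].
  exists (t * a + (1 - t) * b), (t *: K + (1 - t) *: L); split => [i j|i|j||].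
  - have /andP[? ?] := Kb i j; have /andP[? ?] := Lb i j; rewrite !mxE.
    by apply/andP; split; nra.
  - under eq_bigr do rewrite !mxE.
    by rewrite big_split/= -!mulr_sumr Kx Lx; ring.
  - under eq_bigr do rewrite !mxE.
    by rewrite big_split/= -!mulr_sumr Ky Ly; ring.
  - by rewrite cost_lin Km Lm; ring.
  - rewrite cost_lin.
    have := ler_wpM2l (ltW t0) Kd.
    have u0 : 0 <= 1 - t by rewrite subr_ge0 ltW.
    have := ler_wpM2l u0 Ld; lra.
move=> P mu cP /andP[mu0 mu1] gapP.
(* The gap of [P] is [mu * d], so its optimal part has mass [c >= 1 - mu > 0]. *)
have [c [K [Kb Kx Ky Km]]] := QP _ cP; rewrite gapP ler_pM2r// => cmu.
have c0 : 0 < c by lra.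
have c0' := lt0r_neq0 c0; have mu0' := lt0r_neq0 mu0.
have [P0 Px Py] := (couplingP y P hx).1 cP.
(* The optimal part is normalized to [O], of which only mass [1 - mu] is removed from [P]; the rest
   is nonnegative since [(1 - mu) / c <= 1] and [K <= P]. *)
exists (c^-1 *: K), (mu^-1 *: (P - (1 - mu) *: (c^-1 *: K))); split.
- apply/(couplingP _ _ hx); split=> [i j|i|j].
  + by rewrite mxE mulr_ge0 ?invr_ge0 ?(ltW c0)//; have /andP[] := Kb i j.
  + by under eq_bigr do rewrite mxE; rewrite -mulr_sumr Kx mulKf.
  + by under eq_bigr do rewrite mxE; rewrite -mulr_sumr Ky mulKf.
- apply/(couplingP _ _ hx); split=> [i j|i|j].
  + rewrite !mxE mulr_ge0 ?invr_ge0 ?(ltW mu0)// subr_ge0.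
    have /andP[K0 KP] := Kb i j; apply: le_trans KP.
    by rewrite mulrA ler_piMl// ler_pdivrMr// mul1r; lra.
  + under eq_bigr do rewrite !mxE.
    by rewrite -mulr_sumr sumrB Px -!mulr_sumr Kx; field; rewrite c0' mu0'.
  + under eq_bigr do rewrite !mxE.
    by rewrite -mulr_sumr sumrB Py -!mulr_sumr Ky; field; rewrite c0' mu0'.
- rewrite -[_ *: K]addr0 -(scale0r K) cost_lin Km mul0r addr0.
  by rewrite mulKf.
- by apply/matrixP => i j; rewrite !mxE; field; rewrite c0' mu0'.
Qed.

(** * Convexity of the generator [U]: monotone derivative, tangents and chords *)

(** The analytic content of (ii). Regularity at 1 enters as a left limit of [derive1 U], in line
    with the value of [Uprime] there. *)
Record entropy_generator (R : realType) (U : R -> R) : Prop := EntropyGenerator {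
  eg_cont : {within `[0, 1], continuous U};
  eg_der : forall r : R, 0 < r < 1 -> derivable U r 1;
  eg_cvg1 : cvg (derive1 U t @[t --> 1^'-]);
  eg_der2 : forall r : R, 0 < r < 1 -> derivable (derive1 U) r 1;
  eg_pos : forall r : R, 0 < r < 1 -> 0 < derive1 (derive1 U) r;
  eg_lim0 : derive1 U h @[h --> 0^'+] --> -oo;
  eg_mono : forall r s : R, 0 < r -> r <= s -> s < 1 ->
    r * derive1 (derive1 U) r <= s * derive1 (derive1 U) s }.

Lemma eg_is_derive (R : realType) (U : R -> R) (r : R) : entropy_generator U ->
  0 < r < 1 -> is_derive r (1 : R) U (derive1 U r).
Proof. by move=> hU r01; rewrite derive1E; exact/derivableP/eg_der. Qed.

Lemma eg_is_derive2 (R : realType) (U : R -> R) (r : R) : entropy_generator U ->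
  0 < r < 1 -> is_derive r (1 : R) (derive1 U) (derive1 (derive1 U) r).
Proof. by move=> hU r01; rewrite derive1E; exact/derivableP/eg_der2. Qed.

Lemma eg_cont_derive1 (R : realType) (U : R -> R) (a b : R) : entropy_generator U ->
  0 < a -> b < 1 -> {within `[a, b], continuous (derive1 U)}.
Proof.
move=> hU a0 b1; apply: derivable_within_continuous => z.
rewrite in_itv/= => /andP[az zb]; apply: (eg_der2 hU).
by rewrite (lt_le_trans a0 az) (le_lt_trans zb b1).
Qed.

Lemma eg_mvt (R : realType) (U : R -> R) (a b : R) : entropy_generator U ->
  0 <= a -> a < b -> b <= 1 ->
  exists c, [/\ a < c, c < b & U b - U a = derive1 U c * (b - a)].
Proof.
move=> hU a0 ab b1.
have [||c] := @MVT _ U (derive1 U) a b ab.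
    move=> z; rewrite in_itv/= => /andP[az zb]; apply: eg_is_derive => //.
    by rewrite (le_lt_trans a0 az) (lt_le_trans zb b1).
  apply: continuous_subspaceW (eg_cont hU); apply: subset_itv;
  by rewrite bnd_simp.
by rewrite in_itv/= => /andP[ac cb] E; exists c.
Qed.

Lemma eg_derive1_lt (R : realType) (U : R -> R) (a b : R) : entropy_generator U ->
  0 < a -> a < b -> b < 1 -> derive1 U a < derive1 U b.
Proof.
move=> hU a0 ab b1.
have [z|c] := @MVT _ (derive1 U) (derive1 (derive1 U)) a b ab _
  (eg_cont_derive1 hU a0 b1).
  rewrite in_itv/= => /andP[az zb]; apply: eg_is_derive2 => //.
  by rewrite (lt_trans a0 az) (lt_trans zb b1).
rewrite in_itv/= => /andP[ac cb] E.
rewrite -subr_gt0 E mulr_gt0 ?subr_gt0// (eg_pos hU)//.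
by rewrite (lt_trans a0 ac) (lt_trans cb b1).
Qed.

Lemma eg_Uprime_lt (R : realType) (U : R -> R) (a b : R) : entropy_generator U ->
  0 < a -> a < b -> b <= 1 -> Uprime U a < Uprime U b.
Proof.
move=> hU a0 ab; rewrite le_eqVlt /Uprime => /predU1P[b1|b1].
  rewrite b1 ltxx -b1 ab; move: ab; rewrite b1 => a1.
  (* Limits preserve only weak inequalities, so strictness is gained between [a] and the midpoint
     [m]. *)
  have [am m1] := midf_lt a1; set m := (a + 1) / 2 in am m1.
  apply: lt_le_trans (eg_derive1_lt hU a0 am m1) _.
  apply: limr_ge; first exact: (eg_cvg1 hU).
  near=> t; apply/ltW; apply: (eg_derive1_lt hU (lt_trans a0 am)).
    by near: t; exact: nbhs_left_gt.
  by near: t; exact: nbhs_left_lt.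
by rewrite b1 (lt_trans ab b1); exact: eg_derive1_lt.
Unshelve. all: by end_near. Qed.

Lemma eg_Uprime_le (R : realType) (U : R -> R) (a b : R) : entropy_generator U ->
  0 < a -> a <= b -> b <= 1 -> Uprime U a <= Uprime U b.
Proof.
move=> hU a0; rewrite le_eqVlt => /predU1P[->//|ab] b1.
exact/ltW/eg_Uprime_lt.
Qed.

(** By the mean value theorem the chord has slope [U'(c)] with [c] strictly between [r] and [w], to
    be compared with [U'(w)]. The argument reaches [r = 0], where [U'] blows up. *)
Lemma eg_tangent_lt (R : realType) (U : R -> R) (r w : R) : entropy_generator U ->
  0 <= r <= 1 -> 0 < w <= 1 -> r != w ->
  U w + (r - w) * Uprime U w < U r.
Proof.
move=> hU /andP[r0 r1] /andP[w0 w1]; rewrite neq_lt => /orP[rw|wr].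
  have [c [rc cw E]] := eg_mvt hU r0 rw w1.
  have := eg_Uprime_lt hU (le_lt_trans r0 rc) cw w1.
  rewrite {1}/Uprime (lt_le_trans cw w1); nra.
have [c [rc cw E]] := eg_mvt hU (ltW w0) wr r1.
have := eg_Uprime_lt hU w0 rc (ltW (lt_le_trans cw r1)).
rewrite {2}/Uprime (lt_le_trans cw r1); nra.
Qed.

Lemma eg_tangent (R : realType) (U : R -> R) (r w : R) : entropy_generator U ->
  0 <= r <= 1 -> 0 < w <= 1 -> U w + (r - w) * Uprime U w <= U r.
Proof.
move=> hU r01 w01; have [->|rw] := eqVneq r w.
  by rewrite subrr mul0r addr0.
exact/ltW/eg_tangent_lt.
Qed.

(** Average the tangent inequalities at [s * a], taken at [a] and at [0], with weights [s] and
    [1 - s]: the derivative terms cancel. *)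
Lemma eg_chord (R : realType) (U : R -> R) (s a : R) : entropy_generator U ->
  0 <= s <= 1 -> 0 <= a <= 1 -> U (s * a) <= s * U a + (1 - s) * U 0.
Proof.
move=> hU /andP[]; rewrite le_eqVlt => /predU1P[<- _ _|s0 s1].
  by rewrite !mul0r subr0 mul1r add0r.
move=> /andP[]; rewrite le_eqVlt => /predU1P[<- _|a0 a1].
  by rewrite mulr0 -mulrDl addrC subrK mul1r.
have sa : 0 < s * a <= 1 by rewrite mulr_gt0//= mulr_ile1// ltW.
have a01 : 0 <= a <= 1 by rewrite ltW.
have z01 : 0 <= (0 : R) <= 1 by rewrite lexx ler01.
have := eg_tangent hU a01 sa; have := eg_tangent hU z01 sa; nra.
Qed.

(** As fractions [t] and [1 - t] of [p + q], both [p] and [q] obey [eg_chord], and the two bounds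
    add up. *)
Lemma eg_superadd (R : realType) (U : R -> R) (p q : R) : entropy_generator U ->
  0 <= p -> 0 <= q -> p + q <= 1 -> U p + U q <= U (p + q) + U 0.
Proof.
move=> hU p0 q0 pq1; have [pq0|pq0] := eqVneq (p + q) 0.
  have [-> ->] : p = 0 /\ q = 0 by split; lra.
  by rewrite addr0.
have pq : 0 < p + q by rewrite lt_neqAle eq_sym pq0 addr_ge0.
have pq01 : 0 <= p + q <= 1 by rewrite ltW.
have p01 : 0 <= p / (p + q) <= 1.
  by rewrite divr_ge0 ?(ltW pq)//= ler_pdivrMr// mul1r lerDl.
have q01 : 0 <= q / (p + q) <= 1.
  by rewrite divr_ge0 ?(ltW pq)//= ler_pdivrMr// mul1r lerDr.
have := eg_chord hU p01 pq01; have := eg_chord hU q01 pq01.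
rewrite !divfK//; have -> : q / (p + q) = 1 - p / (p + q) by field.
by set t := p / (p + q); lra.
Qed.

(** * Jensen gaps of [U] under monotonicity of [r U''(r)] *)

(** Precomposing with the projection onto [[0, 1]] turns continuity relative to the interval into
    plain continuity, used for limits at the endpoints and for compositions. *)
Lemma eg_extension (R : realType) (U : R -> R) : entropy_generator U ->
  exists2 V : R -> R, continuous V & forall r, 0 <= r <= 1 -> V r = U r.
Proof.
move=> hU; pose c (r : R) := Num.max 0 (Num.min 1 r).
have c01 r : `[0, 1]%classic (c r).
  by rewrite /= in_itv/= /c le_max lexx/= ge_max ler01 ge_min lexx.
exists (U \o c) => [r|r /andP[r0 r1]]; last first.
  by rewrite /= /c (min_idPr r1) (max_idPr r0).
have cc : {for r, continuous c}.
  by apply: continuous_max; [exact: cst_continuous|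
    apply: continuous_min; [exact: cst_continuous|exact: cvg_id]].
apply: (@cvg_comp _ _ _ c U _ (within `[0, 1] (nbhs (c r)))).
  move=> A /= /cc hA; have : \near r, `[0, 1]%classic (c r) -> A (c r) := hA.
  by apply: filterS => z; apply.
by rewrite nbhs_subspace_in//; exact: (eg_cont hU).
Qed.

(* For fixed [b], the map [a |-> U (a b) - b U(a)] is concave: its derivative
   [b (U'(a b) - U'(a))] decreases because [r U''(r)] increases. *)
Lemma eg_mul (R : realType) (U : R -> R) (a b : R) : entropy_generator U ->
  0 <= a <= 1 -> 0 <= b <= 1 ->
  a * U b + b * U a + (1 - a) * (1 - b) * U 0 <= U (a * b) + a * b * U 1.
Proof.
move=> hU /andP[]; rewrite le_eqVlt => /predU1P[<- _ _|a0].
  by rewrite !mul0r subr0 mul1r; lra.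
rewrite le_eqVlt => /predU1P[->|a1]; first by rewrite subrr !mul1r; lra.
(* When [a] or [b] is 0 or 1 both sides agree. *)
move=> /andP[]; rewrite le_eqVlt => /predU1P[<- _|b0].
  by rewrite mulr0 subr0; lra.
rewrite le_eqVlt => /predU1P[->|b1]; first by rewrite subrr !mulr1; lra.
pose g z := U (z * b) - b * U z.
pose dg z := b * (derive1 U (z * b) - derive1 U z).
have zb (z : R) : 0 < z < 1 -> 0 < z * b < 1.
  by move=> /andP[z0 z1]; rewrite mulr_gt0//= mulr_ilt1// ltW.
have dmul (z : R) : is_derive z (1 : R) (fun z : R => z * b) b.
  by apply: is_derive_eq; rewrite scaler0 ?add0r ?addr0 -[RHS]mulr1.
have gD (z : R) : 0 < z < 1 -> is_derive z (1 : R) g (dg z).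
  move=> z01; have h1 := eg_is_derive hU z01.
  have h2 : is_derive (z * b) (1 : R) U (derive1 U (z * b)).
    exact: eg_is_derive (zb _ z01).
  have h3 := @is_derive1_comp _ U (fun z : R => z * b) z _ _ h2 (dmul z).
  have h4 := is_deriveB h3 (is_deriveZ b h1).
  by apply: (is_derive_eq h4); rewrite /dg mulrBr mulrC.
have dgD (z : R) : 0 < z < 1 -> is_derive z (1 : R) dg
    (b * (derive1 (derive1 U) (z * b) * b - derive1 (derive1 U) z)).
  move=> z01; have h1 := eg_is_derive2 hU z01.
  have h2 : is_derive (z * b) (1 : R) (derive1 U) (derive1 (derive1 U) (z * b)).
    exact: eg_is_derive2 (zb _ z01).
  have h3 := @is_derive1_comp _ (derive1 U) (fun z : R => z * b) z _ _ h2 (dmul z).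
  exact: (is_deriveZ b (is_deriveB h3 h1)).
have gc : {within `[0, 1], continuous g}.
  have [V Vc VU] := eg_extension hU.
  apply: (@subspace_eq_continuous R `[0, 1]%classic R
      (fun z : R => V (z * b) - b * V z) g).
    move=> z; rewrite inE/= in_itv/= => /andP[z0 z1]; rewrite /g !VU ?z0//.
    by rewrite mulr_ge0 ?(ltW b0)//= mulr_ile1// ltW.
  apply: continuous_subspaceT => z; apply: cvgB.
    by apply: (@continuous_comp _ _ _ (fun z : R => z * b) V);
      [exact: mulrr_continuous|exact: Vc].
  by apply: cvgMl_tmp; exact: Vc.
have mvt p q : 0 <= p -> p < q -> q <= 1 ->
    exists c, [/\ p < c, c < q & g q - g p = dg c * (q - p)].
  move=> p0 pq q1; have [z||c] := @MVT _ g dg _ _ pq.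
  - rewrite in_itv/= => /andP[pz zq]; apply: gD.
    by rewrite (le_lt_trans p0 pz) (lt_le_trans zq q1).
  - by apply: continuous_subspaceW gc; apply: subset_itv; rewrite bnd_simp.
  - by rewrite in_itv/= => /andP[pc cq] ->; exists c.
(* The slopes of [g] over [[0, a]] and [[a, 1]] are [dg c] and [dg e] with [c < e]; comparing them
   puts [g a] above the chord from 0 to 1. *)
have [c [c0 ca Ec]] := mvt 0 a (lexx _) a0 (ltW a1).
have [e [ae e1 Ee]] := mvt a 1 (ltW a0) a1 (lexx _).
have ce : c < e := lt_trans ca ae.
have dgce : dg e <= dg c.
  have dgi z : c <= z <= e -> 0 < z < 1.
    by move=> /andP[cz ze]; rewrite (lt_le_trans c0 cz) (le_lt_trans ze e1).
  have [z||z] := @MVT _ dg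
    (fun z => b * (derive1 (derive1 U) (z * b) * b - derive1 (derive1 U) z))
    _ _ ce.
  - rewrite in_itv/= => /andP[cz ze]; apply: dgD; apply: dgi.
    by rewrite !ltW.
  - apply: derivable_within_continuous => z; rewrite in_itv/= => /dgi/dgD h.
    exact: ex_derive.
  rewrite in_itv/= => /andP[cz ze] E; rewrite -subr_le0 E.
  have /andP[z0 z1] : 0 < z < 1 by apply: dgi; rewrite !ltW.
  apply: mulr_le0_ge0; last by rewrite subr_ge0 ltW.
  (* Multiplying by [z] turns the sign of the second derivative into a comparison of [r U''(r)] at
     [z * b] and [z]. *)
  rewrite (pmulr_rle0 _ b0) subr_le0 -(ler_pM2l z0).
  have -> (X : R) : z * (X * b) = z * b * X by ring.
  apply: (eg_mono hU) => //; first by rewrite mulr_gt0.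
  by rewrite ler_piMr// ltW.
have a1a : 0 <= a * (1 - a) by rewrite mulr_ge0 ?subr_ge0 ?ltW.
have := ler_wpM2r a1a dgce.
have -> : dg c * (a * (1 - a)) = (1 - a) * (g a - g 0) by rewrite Ec; ring.
have -> : dg e * (a * (1 - a)) = a * (g 1 - g a) by rewrite Ee; ring.
rewrite /g !mul0r !mul1r; lra.
Qed.

(* With [p = (1 - mu) a] and [q = mu b], apply [eg_superadd] to [p + q] and
   [eg_mul] to each of the two products. *)
Lemma eg_jensen_gap (R : realType) (U : R -> R) (mu a b : R) :
  entropy_generator U -> 0 < mu < 1 -> 0 <= a <= 1 -> 0 <= b <= 1 ->
  (1 - mu) * U a + mu * U b - U ((1 - mu) * a + mu * b) <=
  a * ((1 - mu) * U 1 + mu * U 0 - U (1 - mu)) +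
  b * (mu * U 1 + (1 - mu) * U 0 - U mu).
Proof.
move=> hU /andP[mu0 mu1] a01 b01.
have /andP[a0 a1] := a01; have /andP[b0 b1] := b01.
have mu01 : 0 <= mu <= 1 by rewrite !ltW.
have nu01 : 0 <= 1 - mu <= 1 by apply/andP; split; lra.
have ha := eg_mul hU nu01 a01; have hb := eg_mul hU mu01 b01.
have p0 : 0 <= (1 - mu) * a by rewrite mulr_ge0// subr_ge0 ltW.
have q0 : 0 <= mu * b by rewrite mulr_ge0// ltW.
have pq1 : (1 - mu) * a + mu * b <= 1 by nra.
have := eg_superadd hU p0 q0 pq1.
set A := U (_ * a) in ha *; set B := U (_ * b) in hb *.
lra.
Qed.

(** The function [k] below has derivative [nu - U'(1 - s) - s U''(s)], nonnegative up to [r] by the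
    bound on [nu]. Hence [k mu] dominates the values of [k] near 0, which are asymptotically at
    least [U 0 + U 1]. *)
Lemma eg_binary_gap (R : realType) (U : R -> R) (mu nu r : R) :
  entropy_generator U -> 0 < mu -> mu <= r -> r < 1 ->
  (forall s, 0 < s <= r -> Uprime U (1 - s) + s * Usecond U s <= nu) ->
  U 0 + U 1 - U mu - U (1 - mu) <= mu * (nu - Uprime U mu).
Proof.
move=> hU mu0 mur r1 hnu; have mu1 := le_lt_trans mur r1.
rewrite /Uprime mu1.
pose k (s : R) := nu * s - s * derive1 U s + U s + U (1 - s).
pose dk (s : R) := nu - derive1 U (1 - s) - s * derive1 (derive1 U) s.
have dsub (z : R) : is_derive z (1 : R) (fun z : R => 1 - z) (-1).
  rewrite -(sub0r 1).
  exact: (is_deriveB (is_derive_cst (1 : R) z (1 : R)) (is_derive_id z (1 : R))).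
have kD (s : R) : 0 < s < 1 -> is_derive s (1 : R) k (dk s).
  move=> s01; have s01' : 0 < 1 - s < 1 by move/andP: s01 => [? ?]; apply/andP; lra.
  have h1 := eg_is_derive hU s01; have h2 := eg_is_derive2 hU s01.
  have h3 : is_derive (1 - s) (1 : R) U (derive1 U (1 - s)).
    exact: eg_is_derive s01'.
  have h4 := @is_derive1_comp _ U (fun z : R => 1 - z) s _ _ h3 (dsub s).
  have h5 := is_deriveM (is_derive_id s (1 : R)) h2.
  have h6 := is_deriveZ nu (is_derive_id s (1 : R)).
  have h7 := is_deriveD (is_deriveD (is_deriveB h6 h5) h1) h4.
  apply: (is_derive_eq h7); rewrite /dk -![_ *: _]/(_ * _); lra.
have kle s : 0 < s -> s < mu -> k s <= k mu.
  move=> s0 smu; rewrite -subr_ge0.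
  have [z||z] := @MVT _ k dk _ _ smu.
  - rewrite in_itv/= => /andP[sz zm]; apply: kD.
    by rewrite (lt_trans s0 sz) (lt_trans zm mu1).
  - apply: derivable_within_continuous => z; rewrite in_itv/= => /andP[sz zm].
    have z01 : 0 < z < 1 by rewrite (lt_le_trans s0 sz) (le_lt_trans zm mu1).
    have := kD _ z01 => h; exact: ex_derive.
  rewrite in_itv/= => /andP[sz zm] ->; apply: mulr_ge0; last by rewrite subr_ge0 ltW.
  have z0 := lt_trans s0 sz; have zr := ltW (lt_le_trans zm mur).
  have /hnu : 0 < z <= r by rewrite z0.
  have z1 : 1 - z < 1 by rewrite ltrBlDr ltrDl.
  by rewrite /Uprime z1 /Usecond /dk; lra.
have [V Vc VU] := eg_extension hU.
suff : U 0 + U 1 <= k mu by rewrite /k; lra.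
(* The term [- s U'(s)] of [k] is left out of the limit: it is nonnegative near 0 because [U'] tends
   to [-oo]. *)
have c0 : nu * s + V s + V (1 - s) @[s --> 0^'+] --> nu * 0 + V 0 + V (1 - 0).
  apply: cvg_at_right_filter; apply: cvgD; [apply: cvgD|].
  - by apply: cvgMl_tmp; exact: cvg_id.
  - exact: Vc.
  - apply: (@continuous_comp _ _ _ (fun z : R => 1 - z) V); last exact: Vc.
    by apply: cvgB; [exact: cvg_cst|exact: cvg_id].
move: c0; rewrite mulr0 add0r subr0 !VU ?lexx ?ler01// => c0.
apply: (cvgr_to_le c0); near=> s.
have s0 : 0 < s by near: s; exact: nbhs_right_gt.
have smu : s < mu by near: s; exact: nbhs_right_lt.
have us : derive1 U s <= 0 by near: s; exact: (cvgrNy_le (eg_lim0 hU)).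
have s1 := lt_trans smu mu1.
rewrite !VU; [|by apply/andP; split; lra|by rewrite !ltW].
apply: le_trans (kle _ s0 smu); rewrite /k.
have : s * derive1 U s <= 0 by rewrite mulr_ge0_le0// ltW.
lra.
Unshelve. all: by end_near. Qed.

(** * The quantities [eU], [RU] and [nuU] are well defined *)

(** Rules out the default value of [xget]: [U'] falls to [-oo] at 0 and rises to its left limit at
    1, so the intermediate value theorem applies; the extreme value of [s] is taken at 1. *)
Lemma eg_eUP (R : realType) (U : R -> R) (s : R) : entropy_generator U ->
  s <= Uprime U 1 -> 0 < eU U s <= 1 /\ Uprime U (eU U s) = s.
Proof.
move=> hU; rewrite /eU => sU.
apply: (@xgetPex _ 0 [set r | 0 < r <= 1 /\ Uprime U r = s]).
move: sU; rewrite le_eqVlt => /predU1P[->|sU].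
  by exists 1; rewrite /= ltr01 lexx.
have [a [a0 a1 as_]] : exists a : R, [/\ 0 < a, a < 1 & derive1 U a <= s].
  near (0 : R)^'+ => a; exists a; split; near: a.
  - exact: nbhs_right_gt.
  - exact: nbhs_right_lt.
  - exact: (cvgrNy_le (eg_lim0 hU)).
have [b [ab b1 sb]] : exists b : R, [/\ a < b, b < 1 & s < derive1 U b].
  near (1 : R)^'- => b; exists b; split; near: b.
  - exact: nbhs_left_gt.
  - exact: nbhs_left_lt.
  - by move: sU; rewrite /Uprime ltxx; apply: cvgr_gt (eg_cvg1 hU) _.
have [||c] := @IVT _ (derive1 U) a b s (ltW ab).
- exact: eg_cont_derive1.
- by rewrite ge_min le_max as_ (ltW sb) orbT.
rewrite in_itv/= => /andP[ac cb] cs; have c1 := le_lt_trans cb b1.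
by exists c; rewrite /= (lt_le_trans a0 ac) ltW// /Uprime c1.
Unshelve. all: by end_near. Qed.

(** The difference [f] vanishes at [1 / 2], increases strictly, and exceeds any bound near 1. *)
Lemma eg_RU_unique (R : realType) (U : R -> R) (D : R) : entropy_generator U ->
  0 < D ->
  exists! r : R, 1 / 2 <= r < 1 /\ Uprime U r - Uprime U (1 - r) = D.
Proof.
move=> hU D0; pose f (z : R) := derive1 U z - derive1 U (1 - z).
have fE (r : R) : 1 / 2 <= r < 1 -> Uprime U r - Uprime U (1 - r) = f r.
  move=> /andP[r0 r1]; have r1' : 1 - r < 1 by lra.
  by rewrite /Uprime r1 r1'.
have flt (r s : R) : 1 / 2 <= r -> r < s -> s < 1 -> f r < f s.
  move=> r0 rs s1; have h1 : derive1 U r < derive1 U s.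
    by apply: eg_derive1_lt => //; lra.
  have h2 : derive1 U (1 - s) < derive1 U (1 - r).
    by apply: eg_derive1_lt => //; lra.
  rewrite /f; lra.
(* With this [h], [f (1 - h) = U'(1 - h) - U'(h)] is at least [U'(1 / 2) - U'(h) >= D]. *)
have [h [h0 h2 uh]] : exists h : R,
    [/\ 0 < h, h < 1 / 2 & derive1 U h <= derive1 U (1 / 2) - D].
  near (0 : R)^'+ => h; exists h; split; near: h.
  - exact: nbhs_right_gt.
  - by apply: nbhs_right_lt; lra.
  - exact: (cvgrNy_le (eg_lim0 hU)).
have le12 : 1 / 2 <= 1 - h by lra.
have [||r] := @IVT _ f (1 / 2) (1 - h) D le12.
- apply: derivable_within_continuous => z; rewrite in_itv/= => /andP[z0 z1].
  have z01 : 0 < z < 1 by apply/andP; lra.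
  have z01' : 0 < 1 - z < 1 by apply/andP; lra.
  have h3 := eg_is_derive2 hU z01.
  have h4 : is_derive (1 - z) (1 : R) (derive1 U) (derive1 (derive1 U) (1 - z)).
    exact: eg_is_derive2 z01'.
  have h5 : is_derive z (1 : R) (fun z : R => 1 - z) (-1).
    rewrite -(sub0r 1).
    exact: (is_deriveB (is_derive_cst (1 : R) z (1 : R)) (is_derive_id z (1 : R))).
  have h6 := @is_derive1_comp _ (derive1 U) (fun z : R => 1 - z) z _ _ h4 h5.
  have := is_deriveB h3 h6 => h7; exact: ex_derive.
- have f12 : f (1 / 2) = 0.
    by rewrite /f (_ : 1 - 1 / 2 = 1 / 2) ?subrr//; lra.
  have fh : D <= f (1 - h).
    have : derive1 U (1 / 2) < derive1 U (1 - h).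
      by apply: eg_derive1_lt => //; lra.
    by rewrite /f opprB addrCA subrr addr0; lra.
  by rewrite ge_min f12 (ltW D0) le_max fh orbT.
rewrite in_itv/= => /andP[r12 rh] fr; have r1 : 1 / 2 <= r < 1 by apply/andP; lra.
exists r; split => [|s [s12 sD]]; first by rewrite fE.
move: sD; rewrite fE// => fs; have /andP[s0 s1] := s12; have /andP[_ r1'] := r1.
have [rs|sr|//] := ltgtP r s.
  by have := flt _ _ r12 rs s1; rewrite fr fs ltxx.
by have := flt _ _ s0 sr r1'; rewrite fr fs ltxx.
Unshelve. all: by end_near. Qed.

Lemma ereal_sup_image_fin (R : realType) (T : Type) (f : T -> R) (S : set T)
    (a : T) (M : R) : S a -> (forall s, S s -> f s <= M) ->
  exists n, ereal_sup [set (f s)%:E | s in S] = n%:E /\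
            forall s, S s -> f s <= n.
Proof.
move=> Sa SM; have ub : has_ubound (f @` S) by exists M => _ [s Ss <-]; exact: SM.
exists (sup (f @` S)); split => [|s Ss]; last first.
  by apply: ub_le_sup => //; exists s.
by rewrite -ereal_sup_EFin//; [rewrite image_comp|exists (f a), a].
Qed.

(** Both summands are bounded above by monotonicity. Letting [s] tend to 0 gives the lower bound
    [U'(1)], which makes the second denominator in the interval positive. *)
Lemma eg_nu (R : realType) (U : R -> R) (r : R) : entropy_generator U ->
  0 < r < 1 -> exists n, [/\
    ereal_sup [set (Uprime U (1 - s) + s * Usecond U s)%:E |
                 s in `]0, r]%classic] = n%:E,
    Uprime U 1 <= n &
    forall s, 0 < s <= r -> Uprime U (1 - s) + s * Usecond U s <= n].
Proof.
move=> hU /andP[r0 r1].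
have [||n [nE nub]] := @ereal_sup_image_fin R R
  (fun s => Uprime U (1 - s) + s * Usecond U s) `]0, r]%classic r
  (Uprime U 1 + r * Usecond U r).
- by rewrite /= in_itv/= r0 lexx.
- move=> s; rewrite /= in_itv/= => /andP[s0 sr]; apply: lerD.
    by apply: (eg_Uprime_le hU) => //; lra.
  exact: (eg_mono hU).
exists n; split => //.
rewrite {1}/Uprime ltxx; apply: limr_le; first exact: (eg_cvg1 hU).
near=> t.
have t1 : t < 1 by near: t; exact: nbhs_left_lt.
have rt : 1 - r < t by near: t; apply: nbhs_left_gt; lra.
have : Uprime U (1 - (1 - t)) + (1 - t) * Usecond U (1 - t) <= n.
  by apply: nub; rewrite /= in_itv/=; apply/andP; lra.
rewrite {1}/Uprime subKr t1; apply: le_trans; rewrite lerDl.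
apply: mulr_ge0; first by lra.
by apply/ltW/(eg_pos hU)/andP; lra.
Unshelve. all: by end_near. Qed.

(** * The divergence from [otimes x y], restricted to couplings *)

(** Near 0, [U 0 - U t + t U'(t)] is nonnegative by the tangent inequality and at most [U 0 - U t]
    since [U'(t) <= 0]. *)
Lemma eg_dU00 (R : realType) (U : R -> R) : entropy_generator U ->
  dU U 0 0 = 0%E.
Proof.
move=> hU; rewrite /dU ltxx; apply: cvg_lim => //.
apply: cvg_EFin; first by near=> t.
have [V Vc VU] := eg_extension hU.
have : V 0 - V t @[t --> 0^'+] --> V 0 - V 0.
  by apply: cvg_at_right_filter; apply: cvgB; [exact: cvg_cst|exact: Vc].
rewrite subrr => V0.
apply: squeeze_cvgr (cvg_cst (0 : R)) V0; near=> t.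
have t0 : 0 < t by near: t; exact: nbhs_right_gt.
have t1 : t < 1 by near: t; exact: nbhs_right_lt.
have ut : derive1 U t <= 0 by near: t; exact: (cvgrNy_le (eg_lim0 hU)).
have z01 : 0 <= (0 : R) <= 1 by rewrite lexx ler01.
have t01 : 0 < t <= 1 by rewrite t0 ltW.
have := eg_tangent hU z01 t01; rewrite !VU//; last by rewrite !ltW.
rewrite /Uprime t1 => h; rewrite /= t1; apply/andP; split; first by lra.
by nra.
Unshelve. all: by end_near. Qed.

(* At [w = 0] a coupling only meets [d_U(0, 0)], which is [0]. *)
Definition breg (R : realType) (U : R -> R) (r w : R) : R :=
  if 0 < w then U r - U w - (r - w) * Uprime U w else 0.

Definition mbreg (R : realType) (U : R -> R) (I J : nat) (P W : 'M[R]_(I, J)) : R :=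
  \sum_(i < I) \sum_(j < J) breg U (P i j) (W i j).

(** An entry is bounded by both of its marginals, hence vanishes with their product; this keeps the
    divergence of couplings finite. *)
Lemma coupling_entry (R : realType) (I J : nat) (x : 'I_I -> R) (y : 'I_J -> R)
    (P : 'M[R]_(I, J)) i j : prob_vec x -> prob_vec y -> coupling x y P ->
  [/\ 0 <= P i j <= 1, 0 <= otimes x y i j <= 1 &
      otimes x y i j = 0 -> P i j = 0].
Proof.
move=> hx hy cP; have [P0 [_ [Px Py]]] := cP.
split; first by rewrite P0 (coupling_le1 _ _ cP).
  have cW := coupling_otimes hx hy.
  by rewrite (coupling_le1 _ _ cW) (proj1 cW).
have Pxi : P i j <= x i by rewrite -Px (bigD1 j)//= lerDl sumr_ge0.
have Pyj : P i j <= y j by rewrite -Py (bigD1 i)//= lerDl sumr_ge0.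
rewrite mxE => /eqP; rewrite mulf_eq0 => /orP[]/eqP e; apply/eqP;
  by rewrite eq_le P0 andbT -e.
Qed.

Lemma dU_breg (R : realType) (U : R -> R) (r w : R) : entropy_generator U ->
  0 <= w -> (w = 0 -> r = 0) -> dU U r w = (breg U r w)%:E.
Proof.
move=> hU; rewrite le_eqVlt => /predU1P[<- /(_ erefl) ->|w0 _].
  by rewrite eg_dU00// /breg ltxx.
by rewrite /dU /breg w0.
Qed.

Lemma DU_mbreg (R : realType) (U : R -> R) (I J : nat) (x : 'I_I -> R)
    (y : 'I_J -> R) (P : 'M[R]_(I, J)) : entropy_generator U ->
  prob_vec x -> prob_vec y -> coupling x y P ->
  DU U P (otimes x y) = (mbreg U P (otimes x y))%:E.
Proof.
move=> hU hx hy cP; rewrite /DU /mbreg -sumEFin; apply: eq_bigr => i _.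
rewrite -sumEFin; apply: eq_bigr => j _.
have [_ /andP[w0 _] w0P] := coupling_entry i j hx hy cP.
exact: dU_breg.
Qed.

Lemma breg_ge0 (R : realType) (U : R -> R) (r w : R) : entropy_generator U ->
  0 <= r <= 1 -> w <= 1 -> 0 <= breg U r w.
Proof.
move=> hU r01 w1; rewrite /breg; case: ifPn => // w0.
by have := @eg_tangent _ U r w hU r01; rewrite w0 w1 => /(_ isT); lra.
Qed.

Lemma mbreg_ge0 (R : realType) (U : R -> R) (I J : nat) (x : 'I_I -> R)
    (y : 'I_J -> R) (P : 'M[R]_(I, J)) : entropy_generator U ->
  prob_vec x -> prob_vec y -> coupling x y P -> 0 <= mbreg U P (otimes x y).
Proof.
move=> hU hx hy cP; apply: sumr_ge0 => i _; apply: sumr_ge0 => j _.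
have [P01 /andP[_ w1] _] := coupling_entry i j hx hy cP.
exact: breg_ge0.
Qed.

Lemma mbreg_gt0 (R : realType) (U : R -> R) (I J : nat) (x : 'I_I -> R)
    (y : 'I_J -> R) (P : 'M[R]_(I, J)) : entropy_generator U ->
  prob_vec x -> prob_vec y -> coupling x y P -> P <> otimes x y ->
  0 < mbreg U P (otimes x y).
Proof.
move=> hU hx hy cP PW.
have b0 i j : 0 <= breg U (P i j) (otimes x y i j).
  by have [P01 /andP[_ w1] _] := coupling_entry i j hx hy cP; exact: breg_ge0.
rewrite lt_neqAle eq_sym mbreg_ge0// andbT; apply/eqP => s0; apply: PW.
apply/matrixP => i j; apply/eqP/negPn/negP => Pij.
have [P01 /andP[w0 w1] w0P] := coupling_entry i j hx hy cP.
have s1 : \sum_(l < J) breg U (P i l) (otimes x y i l) = 0.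
  apply: (psumr_eq0P _ s0) => // k _; exact: sumr_ge0.
have s2 : breg U (P i j) (otimes x y i j) = 0 by exact: (psumr_eq0P _ s1).
have wp : 0 < otimes x y i j.
  rewrite lt_neqAle w0 andbT eq_sym; apply: contraNN Pij => /eqP e.
  by rewrite e w0P.
have w01 : 0 < otimes x y i j <= 1 by rewrite wp w1.
have := eg_tangent_lt hU P01 w01 Pij.
move: s2; rewrite /breg wp; lra.
Qed.

(** The reference point is fixed, so each [U'(w)] is a constant; [U] is bounded by its maximum and
    [r - w] by 1 in absolute value. *)
Lemma mbreg_bounded (R : realType) (U : R -> R) (I J : nat) (x : 'I_I -> R)
    (y : 'I_J -> R) : entropy_generator U -> prob_vec x -> prob_vec y ->
  exists M, forall P : 'M[R]_(I, J), coupling x y P ->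
    mbreg U P (otimes x y) <= M.
Proof.
move=> hU hx hy; have [c _ cmax] := EVT_max ler01 (eg_cont hU).
pose w := otimes x y.
exists (\sum_(i < I) \sum_(j < J)
  (if 0 < w i j then U c - U (w i j) + `|Uprime U (w i j)| else 0)).
move=> P cP; apply: ler_sum => i _; apply: ler_sum => j _.
have [/andP[P0 P1] /andP[w0 w1] _] := coupling_entry i j hx hy cP.
rewrite /breg; case: ifPn => // wp; apply: lerD.
  by rewrite lerB// cmax// in_itv/= P0.
apply: le_trans (ler_norm _) _; rewrite normrN normrM ler_piMl//.
by rewrite ler_norml; apply/andP; rewrite /w; split; lra.
Qed.

(** Terms affine in the coupling cancel, so only the Jensen gap of [U] in each entry remains. The
    bound of [eg_jensen_gap] is linear in the entries, which sum to 1. *)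
Lemma mbreg_jensen (R : realType) (U : R -> R) (I J : nat) (x : 'I_I -> R)
    (y : 'I_J -> R) (O N : 'M[R]_(I, J)) (mu : R) : entropy_generator U ->
  prob_vec x -> prob_vec y -> coupling x y O -> coupling x y N -> 0 < mu < 1 ->
  (1 - mu) * mbreg U O (otimes x y) + mu * mbreg U N (otimes x y) <=
  mbreg U ((1 - mu) *: O + mu *: N) (otimes x y) +
  (U 0 + U 1 - U mu - U (1 - mu)).
Proof.
move=> hU hx hy cO cN mu01.
pose a := (1 - mu) * U 1 + mu * U 0 - U (1 - mu).
pose b := mu * U 1 + (1 - mu) * U 0 - U mu.
have -> : U 0 + U 1 - U mu - U (1 - mu) =
    \sum_(i < I) \sum_(j < J) (O i j * a + N i j * b).
  under eq_bigr do rewrite big_split/= -!mulr_suml.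
  rewrite big_split/= -!mulr_suml (proj1 (proj2 cO)) (proj1 (proj2 cN)).
  by rewrite /a /b; ring.
rewrite /mbreg !mulr_sumr -!big_split/=; apply: ler_sum => i _.
rewrite !mulr_sumr -!big_split/=; apply: ler_sum => j _.
have [oO /andP[w0 _] w0O] := coupling_entry i j hx hy cO.
have [N01 _ w0N] := coupling_entry i j hx hy cN.
rewrite !mxE in w0 w0O w0N *.
rewrite /breg; case: ifPn => wp.
  by have := eg_jensen_gap hU mu01 oO N01; rewrite -/a -/b; lra.
have e : x i * y j = 0 by apply/eqP; rewrite eq_le w0 andbT leNgt.
by rewrite w0O// w0N// !mulr0 !mul0r !addr0.
Qed.

(** * Existence of the regularized minimizer *)

(** Flattened to row vectors, couplings form a closed subset of a cube, hence a compact set. *)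
Lemma coupling_argmin (R : realType) (I J : nat) (x : 'I_I -> R)
    (y : 'I_J -> R) (phi : 'I_I -> 'I_J -> R -> R) :
  prob_vec x -> prob_vec y -> (forall i j, continuous (phi i j)) ->
  exists2 P, coupling x y P & forall Q, coupling x y Q ->
    \sum_(i < I) \sum_(j < J) phi i j (P i j) <=
    \sum_(i < I) \sum_(j < J) phi i j (Q i j).
Proof.
move=> hx hy phic.
have entryc i j : continuous (fun v : 'rV[R]_(I * J) => vec_mx v i j).
  rewrite (_ : (fun _ => _) = fun v : 'rV[R]_(I * J) => v 0 (mxvec_index i j)).
    exact: coord_continuous.
  by apply: funext => v; rewrite mxE.
have sumc n (f : 'I_n -> 'rV[R]_(I * J) -> R) : (forall k, continuous (f k)) ->
    continuous (fun v => \sum_(k < n) f k v).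
  by move=> fc; apply: continuous_big => //; exact: add_continuous.
have eqclosed n (f : 'I_n -> 'rV[R]_(I * J) -> R) (c : 'I_n -> R) :
    (forall k, continuous (f k)) -> closed [set v | forall k, f k v = c k].
  move=> fc; rewrite (_ : [set _ | _] = \bigcap_(k in setT) (f k @^-1` [set c k])).
    apply: closed_bigI => k _; apply: preimage_closed => [v _|]; first exact: fc.
    exact: closed_eq.
  by apply/seteqP; split => v /= h k => [_|]; exact: h.
pose box := [set v : 'rV[R]_(I * J) | forall k, `[0, 1]%classic (v ord0 k)].
have boxc : compact box.
  by apply: (@rV_compact R _ (fun=> `[0, 1]%classic)) => k; exact: segment_compact.
pose K := box `&` [set v | forall i, \sum_(j < J) vec_mx v i j = x i]
              `&` [set v | forall j, \sum_(i < I) vec_mx v i j = y j].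
have Kc : compact K.
  apply: compact_closedI; first apply: compact_closedI => //.
    by apply: eqclosed => i; apply: sumc => j; exact: entryc.
  by apply: eqclosed => j; apply: sumc => i; exact: entryc.
have KP v : K v <-> coupling x y (vec_mx v).
  split => [[[vbox vx] vy]|cv].
    apply/(couplingP _ _ hx); split => // i j; rewrite mxE.
    by have := vbox (mxvec_index i j); rewrite /= in_itv/= => /andP[].
  have [v0 vx vy] := (couplingP y (vec_mx v) hx).1 cv.
  split => //; split => // k; case/mxvec_indexP: k => i j.
  have := v0 i j; have := coupling_le1 i j cv.
  by rewrite /= in_itv/= !mxE => -> ->.
have K0 : K !=set0.
  exists (mxvec (otimes x y)); apply/KP; rewrite mxvecK; exact: coupling_otimes.
have Fc : continuous (fun v : 'rV[R]_(I * J) =>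
    \sum_(i < I) \sum_(j < J) phi i j (vec_mx v i j)).
  apply: (sumc _) => i; apply: (sumc _) => j v.
  by apply: continuous_comp; [exact: entryc|exact: phic].
have [v vK vmin] := compact_EVT_min K0 Kc (continuous_subspaceT Fc).
rewrite inE in vK; exists (vec_mx v); first exact/KP.
move=> Q cQ; have := vmin (mxvec Q); rewrite mxvecK; apply.
by rewrite inE; apply/KP; rewrite mxvecK.
Qed.

Lemma PiU_is_PiU (R : realType) (I J : nat) (C : 'M[R]_(I, J))
    (x : 'I_I -> R) (y : 'I_J -> R) (U : R -> R) (eps : R) :
  entropy_generator U -> prob_vec x -> prob_vec y ->
  is_PiU U C x y eps (PiU U C x y eps).
Proof.
move=> hU hx hy; apply: xgetPex.
have [V Vc VU] := eg_extension hU; pose w := otimes x y.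
pose phi i j (r : R) := C i j * r + eps *
  (if 0 < w i j then V r - U (w i j) - (r - w i j) * Uprime U (w i j) else 0).
have [|P cP Pmin] := @coupling_argmin R I J x y phi hx hy.
  move=> i j r; apply: cvgD; first by apply: cvgMl_tmp; exact: cvg_id.
  apply: cvgMl_tmp; case: ifP => _; last exact: cvg_cst.
  apply: cvgB; first by apply: cvgB; [exact: Vc|exact: cvg_cst].
  by apply: cvgMr_tmp; apply: cvgB; [exact: cvg_id|exact: cvg_cst].
have phiE Q : coupling x y Q -> \sum_(i < I) \sum_(j < J) phi i j (Q i j) =
    cost C Q + eps * mbreg U Q w.
  move=> cQ; rewrite /cost /mbreg mulr_sumr -big_split/=; apply: eq_bigr => i _.
  rewrite mulr_sumr -big_split/=; apply: eq_bigr => j _.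
  have [Q01 _ _] := coupling_entry i j hx hy cQ.
  by rewrite /phi VU.
exists P; split=> // Q cQ; rewrite !DU_mbreg// -!EFinM -!EFinD lee_fin.
by rewrite -!phiE// Pmin.
Qed.

Theorem theorem1p7 (R : realType) (I J : nat) (C : 'M[R]_(I, J))
  (x : 'I_I -> R) (y : 'I_J -> R) (U : R -> R)
  (hx : prob_vec x) (hy : prob_vec y)
  (* (i) *)
  (hi : coupling x y <> argmin_cost C (coupling x y))
  (* (ii) U in C([0,1]) *)
  (hUc : {within `[0, 1], continuous U})
  (* U in C^1((0,1]) *)
  (hU1 : forall r, 0 < r < 1 -> derivable U r 1)
  (hU1c : {within `]0, 1[, continuous (derive1 U)})
  (hU1l : cvg (derive1 U t @[t --> 1^'-]))
  (hU1d : (U (1 + h) - U 1) / h @[h --> 0^'-] --> lim (derive1 U t @[t --> 1^'-]))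
  (* U in C^2((0,1)) *)
  (hU2 : forall r, 0 < r < 1 -> derivable (derive1 U) r 1)
  (hU2c : {within `]0, 1[, continuous (derive1 (derive1 U))})
  (* U'' > 0 on (0,1) *)
  (hpos : forall r, 0 < r < 1 -> 0 < derive1 (derive1 U) r)
  (* lim_{h -> 0+} U'(h) = -oo *)
  (hlim0 : derive1 U h @[h --> 0^'+] --> -oo)
  (* r |-> r U''(r) non-decreasing on (0,1) *)
  (hmono : forall r s, 0 < r -> r <= s -> s < 1 ->
     r * derive1 (derive1 U) r <= s * derive1 (derive1 U) s) :
  let d := fine (DeltaC C x y) in
  let D := fine (DfrakU U x y) in
  let nu := fine (nuU U x y) in
  let Rr := RU U x y in
  [/\ (* the interval is well defined *)
      DeltaC C x y = d%:E /\ 0 < d,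
      DfrakU U x y = D%:E /\ 0 < D,
      (exists! r, 1/2 <= r < 1 /\ Uprime U r - Uprime U (1 - r) = D),
      nuU U x y = nu%:E /\ 0 < D + nu - Uprime U 1
    & (* nonempty *)
      (exists eps, 0 < eps /\ eps <= d * Rr / D /\ eps <= d / (D + nu - Uprime U 1)) /\
      (* the estimate *)
      forall eps, 0 < eps -> eps <= d * Rr / D -> eps <= d / (D + nu - Uprime U 1) ->
        ((cost C (PiU U C x y eps))%:E - min_cost C x y
          <= (d * eU U (- (d / eps) + D + nu))%:E)%E].
Proof.
have hU : entropy_generator U := EntropyGenerator hUc hU1 hU1l hU2 hpos hlim0 hmono.
have [m [d [d0 dE mE [Q0 cQ0 Q0m] mdec]]] := cost_gap hx hy hi.
pose w := otimes x y; have cw : coupling x y w := coupling_otimes hx hy.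
have [D [DE D0 Dub]] : exists D, [/\ DfrakU U x y = D%:E, 0 < D &
    forall P, coupling x y P -> mbreg U P w <= D].
  have [M hM] := mbreg_bounded hU hx hy.
  have [D [DE Dub]] := ereal_sup_image_fin cw hM.
  exists D; split=> //.
    by rewrite -DE; congr ereal_sup; apply: eq_imagel => P cP; exact: DU_mbreg.
  (* By (i) there is a coupling other than [w], as a single coupling would be its own argmin; its
     divergence makes [D] positive. *)
  have [P [cP Pw]] : exists P, coupling x y P /\ P <> w.
    apply: contrapT => nP; have cE P : coupling x y P -> P = w.
      by move=> cP; apply: contrapT => Pw; apply: nP; exists P.
    apply: hi; apply/seteqP; split => [P cP|P []//]; split => // Q cQ.
    by rewrite (cE _ cP) (cE _ cQ).
  exact: lt_le_trans (mbreg_gt0 hU hx hy cP Pw) (Dub _ cP).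
have exR := eg_RU_unique hU D0.
have [R12 RE] : 1 / 2 <= RU U x y < 1 /\
    (Uprime U (RU U x y) - Uprime U (1 - RU U x y))%:E = DfrakU U x y.
  apply: (@xgetPex _ 0 [set r | 1/2 <= r < 1 /\
    (Uprime U r - Uprime U (1 - r))%:E = DfrakU U x y]).
  by have [r [[r12 rD] _]] := exR; exists r; split=> //; rewrite DE rD.
have /andP[Rhalf R1] := R12; have R0 : 0 < RU U x y by lra.
have R01 : 0 < RU U x y < 1 by rewrite R0.
have [nu [nuE nuge nuub]] := eg_nu hU R01.
have nuUE : nuU U x y = nu%:E by [].
rewrite dE DE nuUE /=.
have c0 : 0 < D + nu - Uprime U 1 by lra.
split => //; split.
  exists (Num.min (d * RU U x y / D) (d / (D + nu - Uprime U 1))).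
  by rewrite lt_min !ge_min !lexx orbT !divr_gt0// mulr_gt0.
move=> eps eps0 eps1 eps2.
have [] := PiU_is_PiU C eps hU hx hy.
set P := PiU U C x y eps => cP Pmin.
rewrite mE -EFinB lee_fin.
(* The second bound on [eps], rearranged: the argument of [eU] stays in the range of [U']. *)
have sle : - (d / eps) + D + nu <= Uprime U 1.
  move: eps2; rewrite ler_pdivlMr// mulrC -ler_pdivlMr//; lra.
have [/andP[e0 e1] eE] := eg_eUP hU sle.
have [gap0|gap0] := leP (cost C P - m) 0.
  by apply: le_trans gap0 _; rewrite mulr_ge0// ltW.
pose mu := (cost C P - m) / d; have mu0 : 0 < mu by rewrite divr_gt0.
have muE : cost C P - m = mu * d by rewrite /mu divfK// gt_eqF.
have cmp Q : coupling x y Q -> cost C Q = m ->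
    mu * d <= eps * (mbreg U Q w - mbreg U P w).
  move=> cQ Qm; have := Pmin _ cQ.
  by rewrite !DU_mbreg// -!EFinM -!EFinD lee_fin Qm -/w; lra.
have DP : 0 <= mbreg U P w := mbreg_ge0 hU hx hy cP.
(* Any optimal coupling serves for this first comparison. It yields [mu < 1], required before [P]
   can be split; the second comparison uses the optimal part of [P] itself. *)
have muR : mu <= RU U x y.
  rewrite -(ler_pM2r d0); apply: le_trans (cmp _ cQ0 Q0m) _.
  move: eps1; rewrite ler_pdivlMr// [d * _]mulrC; apply: le_trans.
  by rewrite ler_pM2l//; have := Dub _ cQ0; lra.
have mu1 : mu < 1 := le_lt_trans muR R1.
have mu01 : 0 < mu < 1 by rewrite mu0.
have [V [N [cV cN Vm PE]]] := mdec P mu cP mu01 muE.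
have hJ := mbreg_jensen hU hx hy cV cN mu01.
have hB := eg_binary_gap hU mu0 muR R1 nuub.
have hV := Dub _ cV; have hN := mbreg_ge0 hU hx hy cN.
(* The Jensen bound leaves [mu] times the divergence of [V] minus that of [N], estimated by [D] and
   0 respectively. *)
have hdiff : mbreg U V w - mbreg U P w <= mu * (D + nu - Uprime U mu).
  have : mu * (mbreg U V w - mbreg U N w) <= mu * D.
    by rewrite ler_pM2l//; move: hN; rewrite -/w; lra.
  move: hJ; rewrite -PE -/w; lra.
have : d <= eps * (D + nu - Uprime U mu).
  rewrite -(ler_pM2l mu0) mulrCA; apply: le_trans (cmp _ cV Vm) _.
  by rewrite ler_pM2l.
rewrite -ler_pdivrMl// mulrC => dle.
(* Were [eU] below [mu], strict monotonicity of [U'] would contradict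
   [d / eps <= D + nu - U'(mu)]. *)
rewrite muE mulrC ler_pM2l// leNgt; apply/negP => emu.
have := eg_Uprime_lt hU e0 emu (ltW mu1).
rewrite eE; lra.
Qed.
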